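(* Let $\Lambda_1$ and $\Lambda_2$ be two subsets of $\mathbb{P}(\mathbb{R}^{p,q})$ spanning non-degenerate subspaces of $\mathbb{R}^{p,q}$. Let $\iota:\Lambda_1\to\Lambda_2$ be a map. The following conditions are equivalent: (1) $\iota$ extends to an element of $\mathrm{PO}(p,q)$; (2) $\iota$ defines an isomorphism of graphs $\mathcal{G}(\Lambda_1)\to\mathcal{G}(\Lambda_2)$ and we have $c(\Lambda_1)=\iota^*c(\Lambda_2)$ in $\mathrm{H}^1(\mathcal{G}(\Lambda_1),\mathbb{R}^* )$.
   Context: Let $\mathbb{R}^{p,q}$ be $\mathbb{R}^{p+q}$ endowed with a non-degenerate symmetric bilinear form $\mathbf{b}$ of signature $(p,q)$ (where $p>0$ and $q\geq 0$ are integers), $\mathrm{O}(p,q)$ its orthogonal group and $\mathrm{PO}(p,q)=\mathrm{O}(p,q)/\{\pm\mathrm{id}\}$, which acts on the projective space $\mathbb{P}(\mathbb{R}^{p,q})$. The subsets $\Lambda_i$ may be infinite. A graph $\mathcal{G}=(\mathcal{S},\mathcal{A})$ is a set $\mathcal{S}$ of vertices with a set $\mathcal{A}$ of edges, each a subset $\{\xi,\eta\}$ of $\mathcal{S}$ with possibly $\xi=\eta$ (a loop). A morphism of graphs is a map between the vertex sets sending edges to edges; an isomorphism of graphs is a bijection between the vertex sets which, together with its inverse, is a morphism. For $\Lambda\subset\mathbb{P}(\mathbb{R}^{p,q})$, $\mathcal{G}(\Lambda)$ is the graph with vertex set $\Lambda$ whose edges are the $\{\xi,\eta\}\subset\Lambda$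 (possibly $\xi=\eta$) such that the lines $\xi$ and $\eta$ are not orthogonal for $\mathbf{b}$. For an abelian group $(G,\star)$ and a graph $\mathcal{G}=(\mathcal{S},\mathcal{A})$, define the cochain complex $\mathrm{C}^0(\mathcal{G},G)=G^{\mathcal{S}}$, $\mathrm{C}^1(\mathcal{G},G)=G^{\mathcal{A}}$, zero in other degrees, with differential $\mathrm{d}f(\{\xi,\eta\})=f(\xi)\star f(\eta)$ (so $\mathrm{d}f(\{\xi,\xi\})=f(\xi)\star f(\xi)$). Its cohomology is denoted $\mathrm{H}^k(\mathcal{G},G)$. A graph morphism $\iota:\mathcal{G}_1\to\mathcal{G}_2$ induces $\iota^*:\mathrm{H}^1(\mathcal{G}_2,G)\to\mathrm{H}^1(\mathcal{G}_1,G)$ by $(\iota^*f)(\{\xi,\eta\})=f(\{\iota(\xi),\iota(\eta)\})$. Here $G=\mathbb{R}^*$, the multiplicative group. A lift of $\Lambda$ is a map $s$ choosing for every line $\xi\in\Lambda$ a non-zero vector $s(\xi)\in\xi$. For a lift $s$, $\mathrm{Gram}(s)\in\mathrm{C}^1(\mathcal{G}(\Lambda),\mathbb{R}^* )$ is given by $\{\xi,\eta\}\mapsto-\mathbf{b}(s(\xi),s(\eta))$. Its cohomology class does not depend on $s$ and is denoted $c(\Lambda)\in\mathrm{H}^1(\mathcal{G}(\Lambda),\mathbb{R}^* )$.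
   Formalization: Condition (1) is read as: ι extends to an element of PO(p,q) and ι is onto Λ2; without surjectivity (1)⇒(2) fails, e.g. for the inclusion of {ξ} in {ξ,η} with ξ, η orthogonal non-isotropic lines, which the identity extends. *)

(* Defs.v *)
From HB Require Import structures.
From mathcomp Require Import all_boot all_order all_algebra.
From mathcomp Require Import generic_quotient ring_quotient sesquilinear.
From mathcomp Require Import boolp classical_sets functions reals.

Set Implicit Arguments.
Unset Strict Implicit.
Unset Printing Implicit Defensive.

Import Order.TTheory GRing.Theory Num.Theory.
Local Open Scope classical_set_scope.
Local Open Scope ring_scope.
Local Open Scope quotient_scope.

(* An edge is a pair or, for a loop, a singleton ([set x; x] = [set x]). *)
Record graph := Graph {
  vertex : Type;
  edge : set (set vertex);
  edge_pair : forall e, edge e -> exists x y, e = [set x; y]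
}.
Arguments edge : clear implicits.

Record graph_mor (G1 G2 : graph) := GraphMor {
  mor_fun :> vertex G1 -> vertex G2;
  mor_edge : forall e, edge G1 e -> edge G2 (mor_fun @` e)
}.

Definition graph_iso (G1 G2 : graph) (phi : graph_mor G1 G2) : Prop :=
  exists psi : graph_mor G2 G1, cancel phi psi /\ cancel psi phi.

Section Endpoints.
Variable G : graph.

Lemma ends_ex (e : edge G) :
  exists xy : vertex G * vertex G, val e = [set xy.1; xy.2].
Proof. by have [x [y exy]] := edge_pair (set_valP e); exists (x, y). Qed.

(* A chosen ordering of the endpoints; below it is only used in expressions
   that are symmetric in the two endpoints. *)
Definition ends (e : edge G) : vertex G * vertex G := projT1 (cid (ends_ex e)).

Lemma endsE (e : edge G) : val e = [set (ends e).1; (ends e).2].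
Proof. exact: projT2 (cid (ends_ex e)). Qed.

Lemma set2_inj (T : Type) (x y x' y' : T) : [set x; y] = [set x'; y'] ->
  (x = x' /\ y = y') \/ (x = y' /\ y = x').
Proof.
move=> E.
have /= hx : [set x'; y'] x by rewrite -E; left.
have /= hy : [set x'; y'] y by rewrite -E; right.
have /= hx' : [set x; y] x' by rewrite E; left.
have /= hy' : [set x; y] y' by rewrite E; right.
by case: hx hy hx' hy' => -> [] -> [] ? [] ?; subst; auto.
Qed.

Lemma ends_sym (T : Type) (F : vertex G -> vertex G -> T) (e : edge G) x y :
  (forall u v, F u v = F v u) -> val e = [set x; y] ->
  F (ends e).1 (ends e).2 = F x y.
Proof. by move=> Fsym; rewrite endsE => E; case: (set2_inj E) => -[-> ->]. Qed.

End Endpoints.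

Section Cohomology.
(* The coefficient group is written additively. *)
Variable A : zmodType.

Definition C0 (G : graph) : zmodType := vertex G -> A.
Definition C1 (G : graph) : zmodType := edge G -> A.

Definition diff (G : graph) (f : C0 G) : C1 G :=
  fun e => f (ends e).1 + f (ends e).2.

Lemma diffE (G : graph) (f : C0 G) (e : edge G) x y :
  val e = [set x; y] -> diff f e = f x + f y.
Proof.
by apply: (ends_sym (F := fun x y => f x + f y)) => u v; rewrite addrC.
Qed.

(* As C^2 = 0, H^1 is the quotient of C^1 by the image of the differential. *)
Definition coboundary (G : graph) : {pred C1 G} :=
  fun c => `[< exists f : C0 G, c = diff f >].

Lemma coboundary_closed (G : graph) : zmod_closed (@coboundary G).
Proof.
split=> [|_ _ /asboolP[f ->] /asboolP[g ->]]; apply/asboolP.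
  by exists 0; apply/funext => e; rewrite /diff addr0.
exists (f - g); apply/funext => e.
by rewrite /diff !fctE opprD addrACA.
Qed.

HB.instance Definition _ (G : graph) :=
  GRing.isZmodClosed.Build (C1 G) (@coboundary G) (@coboundary_closed G).

Definition H1 (G : graph) : zmodType := Quotient.quot (@coboundary G).
Definition cclass (G : graph) (c : C1 G) : H1 G :=
  \pi_(Quotient.quot (@coboundary G)) c.

Lemma cclassP (G : graph) (c c' : C1 G) :
  cclass c = cclass c' <-> exists f : C0 G, c - c' = diff f.
Proof.
split=> [/eqP|h]; last first.
  by apply/eqP; rewrite /cclass -Quotient.idealrBE; apply/asboolP.
by rewrite /cclass -Quotient.idealrBE => /asboolP.
Qed.

Section Pullback.
Variables (G1 G2 : graph) (phi : graph_mor G1 G2).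

Definition edge_map (e : edge G1) : edge G2 :=
  exist _ (phi @` val e) (mem_set (mor_edge phi (set_valP e))).

Definition C1_pull (c : C1 G2) : C1 G1 := fun e => c (edge_map e).

Definition H1_pull (h : H1 G2) : H1 G1 :=
  cclass (C1_pull (repr (h : Quotient.quot (@coboundary G2)))).

Lemma H1_pullE (c : C1 G2) : H1_pull (cclass c) = cclass (C1_pull c).
Proof.
apply/cclassP.
have /cclassP[f fE] :
    cclass (repr (cclass c : Quotient.quot (@coboundary G2))) = cclass c.
  by rewrite /cclass reprK.
exists (f \o phi); apply/funext => e.
have -> : (C1_pull (repr (cclass c : Quotient.quot (@coboundary G2)))
             - C1_pull c) e = diff f (edge_map e) by rewrite -fE.
by rewrite (@diffE _ _ _ (phi (ends e).1) (phi (ends e).2)) //= endsE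
  image_setU !image_set1.
Qed.

End Pullback.
End Cohomology.

(* The multiplicative group of a field F. Its group law, the multiplication
   of F, is written + to fit the additive convention of zmodType. *)
Definition multG (F : fieldType) : Type := {x : F | x != 0}.
HB.instance Definition _ (F : fieldType) := Choice.on (multG F).

Section MultiplicativeGroup.
Variable F : fieldType.
Implicit Types x y z : multG F.

Definition mg_one : multG F := exist _ 1 (oner_neq0 F).
Definition mg_mul x y : multG F :=
  exist _ (val x * val y) (mulf_neq0 (valP x) (valP y)).
Definition mg_inv x : multG F :=
  exist _ (val x)^-1 (invr_neq0 (valP x)).

Lemma mg_mulA : associative mg_mul.
Proof. by move=> x y z; apply: val_inj; rewrite /= mulrA. Qed.
Lemma mg_mulC : commutative mg_mul.
Proof. by move=> x y; apply: val_inj; rewrite /= mulrC. Qed.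
Lemma mg_mul1 : left_id mg_one mg_mul.
Proof. by move=> x; apply: val_inj; rewrite /= mul1r. Qed.
Lemma mg_mulV : left_inverse mg_one mg_inv mg_mul.
Proof. by move=> x; apply: val_inj; rewrite /= mulVf ?(valP x). Qed.

HB.instance Definition _ :=
  GRing.isZmodule.Build (multG F) mg_mulA mg_mulC mg_mul1 mg_mulV.

End MultiplicativeGroup.

Definition proj (F : fieldType) (V : vectType F) : Type :=
  {L : {vspace V} | \dim L == 1%N}.
HB.instance Definition _ (F : fieldType) (V : vectType F) := Choice.on (proj V).

Section Forms.
Variables (F : fieldType) (V : vectType F) (b : {symmetric V}).

Definition ortho_lines (x y : proj V) : bool := (val x <= orthov b (val y))%VS.

(* The subspace spanned by a possibly infinite family of lines, as the union
   of its finite partial sums. *)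
Definition span_lines (Lam : set (proj V)) : set V :=
  [set v | exists s : seq (proj V), (forall x, x \in s -> Lam x) /\
             v \in (\sum_(x <- s) val x)%VS].

Definition nondeg_on (W : set V) : Prop :=
  forall v, W v -> (forall w, W w -> b v w = 0) -> v = 0.

Definition orthogonal_map : pred 'End(V) :=
  fun g => (lker g == 0%VS) && `[< isometry b b g >].

Definition O_group : Type := {g : 'End(V) | orthogonal_map g}.
HB.instance Definition _ := Choice.on O_group.

Definition eq_sign (g h : O_group) : bool :=
  (val g == val h) || (val g == - val h).

Lemma eq_sign_equiv : equiv_class_of eq_sign.
Proof.
split=> [g|g h|h g k]; rewrite /eq_sign ?eqxx //.
  by rewrite [val g == _]eq_sym -eqr_oppLR [- val g == _]eq_sym.
case/orP=> /eqP-> /orP[] /eqP->; by rewrite ?opprK eqxx ?orbT.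
Qed.

Canonical eq_sign_rel := EquivRelPack eq_sign_equiv.
Canonical eq_sign_enc := defaultEncModRel eq_sign.

(* The classes are {g, -g}; [PO_actE] below shows that the action on lines does
   not depend on the representative. *)
Definition PO_group : Type := {eq_quot eq_sign}.

Lemma O_act_dim (g : O_group) (x : proj V) : \dim (val g @: val x) == 1%N.
Proof.
have /andP[/eqP kg _] := valP g.
by rewrite limg_dim_eq ?(valP x) // kg capv0.
Qed.

Definition O_act (g : O_group) (x : proj V) : proj V :=
  exist _ (val g @: val x)%VS (O_act_dim g x).

Definition PO_act (g : PO_group) (x : proj V) : proj V :=
  O_act (repr (g : {eq_quot eq_sign})) x.

Lemma O_act_sign (g h : O_group) x : eq_sign g h -> O_act g x = O_act h x.
Proof.
move=> /orP[] /eqP gh; apply: val_inj; rewrite /= gh //.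
apply/vspaceP => v; apply/memv_imgP/memv_imgP => -[u ux ->];
  by exists (- u); rewrite ?rpredN // ?lfunE /= ?opp_lfunE ?linearN ?opprK.
Qed.

Lemma PO_actE (g : O_group) x : PO_act (\pi_{eq_quot eq_sign} g) x = O_act g x.
Proof.
apply: O_act_sign.
suff /eqmodP : repr (\pi_{eq_quot eq_sign} g) = g %[mod {eq_quot eq_sign}] by [].
by rewrite reprK.
Qed.

Definition extends_to_PO (L1 L2 : set (proj V)) (iota : L1 -> L2) : Prop :=
  exists g : PO_group, forall x : L1, PO_act g (val x) = val (iota x).

Section LinesGraph.
Variable Lam : set (proj V).

Definition lines_edge : set (set Lam) :=
  [set e | exists x y : Lam, e = [set x; y] /\ ~~ ortho_lines (val x) (val y)].

Lemma lines_edge_pair e : lines_edge e -> exists x y, e = [set x; y].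
Proof. by case=> x [y [-> _]]; exists x, y. Qed.

Definition lines_graph : graph := Graph lines_edge_pair.

Record lift_of := Lift {
  lift_fun :> Lam -> V;
  lift_mem : forall x, lift_fun x \in val (val x);
  lift_neq0 : forall x, lift_fun x != 0
}.

Lemma form_sym u v : b u v = b v u.
Proof. by rewrite (@hermitian_subproof _ _ _ _ b) expr0 mul1r. Qed.

Lemma line_span (x : proj V) u : u \in val x -> u != 0 -> val x = <[u]>%VS.
Proof.
move=> ux u0; apply/esym/eqP; rewrite eqEdim -memvE ux /=.
by rewrite (eqP (valP x)) dim_vline u0.
Qed.

Lemma ortho_lines_lift (s : lift_of) x y :
  ortho_lines (val x) (val y) = (b (s x) (s y) == 0).
Proof.
rewrite /ortho_lines (line_span (lift_mem s x) (lift_neq0 s x)).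
by rewrite (line_span (lift_mem s y) (lift_neq0 s y)) orthov11.
Qed.

Lemma gram_neq0 (s : lift_of) (e : edge lines_graph) :
  - b (s (ends e).1) (s (ends e).2) != 0.
Proof.
have /= [x [y [exy nxy]]] := set_valP e.
rewrite oppr_eq0 (ends_sym (F := fun x y : vertex lines_graph => b (s x) (s y)) _ exy); last first.
  by move=> u v; exact: form_sym.
by rewrite -ortho_lines_lift.
Qed.

Definition gram (s : lift_of) : C1 (multG F) lines_graph :=
  fun e => exist _ (- b (s (ends e).1) (s (ends e).2)) (gram_neq0 s e).

Lemma gram_class_lift (s t : lift_of) :
  cclass (gram s) = cclass (gram t).
Proof.
have st x : exists k : multG F, s x = val k *: t x.
  have : s x \in val (val x) by exact: lift_mem.
  rewrite (line_span (lift_mem t x) (lift_neq0 t x)) => /vlineP[k kE].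
  have k0 : k != 0.
    by apply: contra_neq (lift_neq0 s x) => k0; rewrite kE k0 scale0r.
  by exists (exist _ k k0).
have [f fE] := choice st.
apply/cclassP; exists f; apply/funext => e; apply: val_inj => /=.
have := gram_neq0 t e; rewrite !fE linearZl_LR linearZr /=.
set c := b _ _ => c0.
by apply: (mulIf c0); rewrite mulfVK // !mulrN mulrA.
Qed.

Definition vpick_lift : lift_of.
Proof.
exists (fun x => vpick (val (val x))) => x; first exact: memv_pick.
by rewrite vpick0 -dimv_eq0 (eqP (valP (val x))).
Defined.

(* By [gram_class_lift], any other lift gives the same class. *)
Definition lines_class : H1 (multG F) lines_graph :=
  cclass (gram vpick_lift).

End LinesGraph.
End Forms.

Definition has_signature (R : realType) (V : vectType R) (b : {symmetric V})
    (p q : nat) : Prop :=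
  exists e : (p + q).-tuple V, basis_of fullv e /\
    forall i j : 'I_(p + q), b e`_i e`_j =
      if i == j then (if (i < p)%N then 1 else -1) else 0.

(* Main.v *)
Require Import Defs.
From HB Require Import structures.
From mathcomp Require Import all_boot all_order all_algebra.
From mathcomp Require Import generic_quotient ring_quotient sesquilinear.
From mathcomp Require Import boolp classical_sets functions reals.
From mathcomp Require Import ring.

(* Cohomologous Gram cocycles become equal after rescaling the lifts, so that
   there are lifts [s1], [s2] with [b (s2 (iota x)) (s2 (iota y)) = b (s1 x) (s1 y)].
   Non-degeneracy of the span of [L2] makes [s1 x |-> s2 (iota x)] extend to a
   linear isometry between the spans: a linear relation between the [s1 x] gives
   a combination of the [s2 (iota x)] orthogonal to the whole span, hence zero.
   This isometry extends to the whole space by Witt's theorem, proved for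
   non-degenerate subspaces by induction on the dimension: split off an
   anisotropic vector and correct its image with reflections. Conversely, an
   isometry carries a lift of [L1] to a lift of [L2] with the same Gram cocycle. *)

Local Open Scope classical_set_scope.
Local Open Scope ring_scope.

Set Implicit Arguments.
Unset Strict Implicit.
Unset Printing Implicit Defensive.
Import Order.TTheory GRing.Theory Num.Theory.

Lemma span_ind (K : fieldType) (V : vectType K) (X : seq V) (P : V -> Prop) :
  P 0 -> (forall a u v, u \in X -> P v -> P (a *: u + v)) ->
  {in <<X>>%VS, forall v, P v}.
Proof.
move=> P0 PD; elim: X PD => [|x X IHX] PD v.
  by rewrite span_nil memv0 => /eqP ->.
rewrite span_cons => /memv_addP[_ /vlineP[a ->] [w wX ->]].
apply: (PD); first exact: mem_head.
by apply: (IHX _ w wX) => c u w1 uX Pw1; apply: PD => //; rewrite inE uX orbT.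
Qed.

(** * Reflections and Witt's theorem for non-degenerate subspaces *)

Section Witt.
Variables (F : fieldType) (V : vectType F) (b : {symmetric V}).
Hypothesis two_neq0 : (2 : F) != 0.
Implicit Types (u v w x y : V) (U : {vspace V}) (g h : 'End(V)).

Section Reflection.
Variable w : V.

(** For isotropic [w] the inverse of 0 is 0 and this is the identity, so linearity holds for every
    [w]. *)
Definition reflection x : V := x - (2 * b x w / b w w) *: w.

Lemma reflection_linear : linear reflection.
Proof.
move=> a x y; rewrite /reflection linearDl linearZl_LR /=.
rewrite scalerBr scalerA addrACA -opprD -scalerDl.
by congr (_ - _ *: _); ring.
Qed.

HB.instance Definition _ := GRing.isLinear.Build F V V *:%R reflection reflection_linear.

Lemma reflection_isometry : b w w != 0 -> isometry b b (linfun reflection).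
Proof.
move=> w0 x y; rewrite !lfunE /= /reflection.
rewrite !(linearBl, linearBr, linearZl_LR, linearZr) /= (form_sym b w y).
by field.
Qed.

Lemma reflection_fix x : b x w = 0 -> reflection x = x.
Proof. by move=> xw; rewrite /reflection xw mulr0 mul0r scale0r subr0. Qed.

End Reflection.

Lemma reflection_opp w : b w w != 0 -> reflection w w = - w.
Proof.
by move=> w0; rewrite /reflection mulfK // scaler_nat mulr2n opprD addNKr.
Qed.

(** Equal norms make [u + v] orthogonal to [u - v], so the reflection in [u - v] swaps [u] and
    [v]. *)
Lemma reflection_sub u v : b u u = b v v -> b (u - v) (u - v) != 0 ->
  reflection (u - v) u = v.
Proof.
move=> uv w0; rewrite /reflection.
suff -> : 2 * b u (u - v) = b (u - v) (u - v).
  by rewrite divff // scale1r opprB addrCA subrr addr0.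
by rewrite !(linearBl, linearBr) /= -uv (form_sym b v u); ring.
Qed.

(* Since [b (u - v) (u - v) + b (u + v) (u + v) = 4 b v v], one of [u - v],
   [u + v] is anisotropic; in the second case the reflection maps [u] to [- v]
   and is composed with the reflection in [v]. *)
Lemma isometry_transport u v : b u u = b v v -> b v v != 0 ->
  exists g, [/\ isometry b b g, g u = v &
    forall x, b x u = 0 -> b x v = 0 -> g x = x].
Proof.
move=> uv v0; have [w0|w0] := eqVneq (b (u - v) (u - v)) 0; last first.
  exists (linfun (reflection (u - v))); split.
  - exact: reflection_isometry.
  - by rewrite lfunE /= reflection_sub.
  - by move=> x xu xv; rewrite lfunE /= reflection_fix // linearBr /= xu xv subr0.
have p0 : b (u - - v) (u - - v) != 0.
  suff -> : b (u - - v) (u - - v) = 2 * 2 * b v v - b (u - v) (u - v).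
    by rewrite w0 subr0 !mulf_neq0.
  by rewrite !(linearBl, linearBr, linearNl, linearNr) /= uv; ring.
exists (linfun (reflection v) \o linfun (reflection (u - - v)))%VF; split.
- move=> x y; rewrite !comp_lfunE; do 2 rewrite reflection_isometry //.
- rewrite comp_lfunE !lfunE /= reflection_sub //; last first.
    by rewrite linearNl linearNr opprK.
  by rewrite -(opprK v) linearN /= opprK reflection_opp // opprK.
- move=> x xu xv; rewrite comp_lfunE !lfunE /= [reflection (u - - v) x]reflection_fix.
    exact: reflection_fix.
  by rewrite linearBr linearNr /= xu xv opprK addr0.
Qed.

(** Polarization: if all of [U] were isotropic, [2 * b u w] would vanish on [U], and any nonzero
    vector of [U] would lie in its radical. *)
Lemma anisotropic_exists U : nondeg_on b [set` U] -> U != 0%VS ->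
  exists2 u, u \in U & b u u != 0.
Proof.
move=> Und U0; apply: contrapT => noU.
have iso : {in U, forall u, b u u = 0}.
  by move=> u uU; apply/eqP/negPn/negP => u0; apply: noU; exists u.
move/negP: U0; apply; rewrite -vpick0; apply/eqP/Und; first exact: memv_pick.
move=> w wU; set u := vpick U; have uU : u \in U by exact: memv_pick.
apply: (mulfI two_neq0); rewrite mulr0.
have : b (u + w) (u + w) = 0 by apply/iso/rpredD.
by rewrite !(linearDl, linearDr) /= !iso // (form_sym b w u) => <-; ring.
Qed.

Lemma witt_extension U h : nondeg_on b [set` U] ->
  {in U &, forall u v, b (h u) (h v) = b u v} ->
  exists2 g : 'End(V), isometry b b g & {in U, g =1 h}.
Proof.
have [n] := ubnP (\dim U); elim: n U h => // n IHn U h dimU Und hU.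
have [U0|/(anisotropic_exists Und)[u uU u0]] := eqVneq U 0%VS.
  exists \1%VF => [x y|x]; first by rewrite !id_lfunE.
  by rewrite U0 memv0 => /eqP ->; rewrite !linear0.
(* [U] is the orthogonal sum of the line of [u] and [U']; [k x] below is the coefficient of the
   projection to that line. *)
set U' := (U :&: orthov b <[u]>)%VS.
have U'P x : x \in U' = (x \in U) && (b x u == 0).
  by rewrite memv_cap mem_orthov1.
pose k x := b x u / b u u.
have kU x : x \in U -> x - k x *: u \in U'.
  move=> xU; rewrite U'P rpredB ?rpredZ //=.
  by rewrite linearBl linearZl_LR /= divfK // subrr.
have [|x /= xU' xort||g' g'iso g'h] := IHn U' h.
(* The dimension drops: the anisotropic [u] lies in [U] but not in [U']. *)
- rewrite -ltnS; apply: leq_trans dimU; rewrite ltnS ltn_neqAle dimvS ?capvSl // andbT.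
  apply: contraNneq u0 => dU; have /eqP UU : U' == U by rewrite eqEdim capvSl dU leqnn.
  by have := U'P u; rewrite UU uU.
(* A vector of [U'] orthogonal to [U'] is also orthogonal to [u], hence to all of [U]. *)
- move: (xU'); rewrite U'P => /andP[xU /eqP xu]; apply: Und => // w wU.
  by have := xort _ (kU w wU); rewrite linearBr linearZr /= xu mulr0 subr0.
- by move=> x y; rewrite !U'P => /andP[xU _] /andP[yU _]; apply: hU.
(* [g'] is right on [U'] but may send [u] elsewhere than [h u]; both images have the norm of [u], so
   [r] can correct this. *)
have [||r [riso ru rfix]] := @isometry_transport (g' u) (h u).
- by rewrite g'iso hU.
- by rewrite hU.
exists (r \o g')%VF => [x y|x xU]; first by rewrite !comp_lfunE riso g'iso.
have [x' [c [x'U ->]]] : exists x' c, x' \in U' /\ x = x' + c *: u.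
  by exists (x - k x *: u), (k x); rewrite subrK kU.
move: (x'U); rewrite U'P => /andP[x'U1 /eqP x'u].
rewrite comp_lfunE !linearD !linearZ /= ru; congr (_ + _).
(* [g' x' = h x'] is orthogonal to both [g' u] and [h u], so [r] leaves it in place. *)
by rewrite rfix; [rewrite g'h | rewrite g'iso | rewrite g'h // hU].
Qed.

(** The kernel of an isometry lies in the radical of [b]. *)
Lemma isometry_lker0 g : nondegenerate b -> isometry b b g -> lker g == 0%VS.
Proof.
move=> /eqP bnd giso; rewrite -subv0 -bnd; apply/subvP => u.
rewrite memv_ker => /eqP gu; apply/mem_orthovP => v _.
by rewrite -giso gu linear0l.
Qed.

End Witt.

(** * Lifts, spans of families of lines, and Gram cocycles *)

Section Lines.
Variables (F : fieldType) (V : vectType F) (b : {symmetric V}).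
Implicit Types L : set (proj V).

Lemma lift_line L (s : lift_of L) (x : L) : val (val x) = <[s x]>%VS.
Proof. exact: line_span (lift_mem s x) (lift_neq0 s x). Qed.

(** This change of lift adds [diff f] to the Gram cocycle. *)
Definition scale_lift L (f : L -> multG F) (s : lift_of L) : lift_of L.
Proof.
exists (fun x => val (f x) *: s x) => x.
  by rewrite rpredZ ?lift_mem.
by rewrite scaler_eq0 negb_or (valP (f x)) lift_neq0.
Defined.

Lemma span_lines0 L : span_lines L 0.
Proof. by exists [::]; split=> //; rewrite big_nil mem0v. Qed.

Lemma span_lines_comb L (x : L) a u v :
  u \in val (val x) -> span_lines L v -> span_lines L (a *: u + v).
Proof.
move=> ux [l [lL vl]]; exists (val x :: l); split=> [y|].
  by rewrite inE => /orP[/eqP ->|/lL //]; exact: set_valP.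
by rewrite big_cons memv_add ?rpredZ.
Qed.

(** Turns the span of a possibly infinite family into a genuine subspace. Free families of lifts
    have length at most the dimension of [V], and one of maximal length spans, since any [s x]
    outside its span could be added. *)
Lemma span_lines_basis L (s : lift_of L) :
  exists xs : seq L, free (map s xs) /\ span_lines L = [set` <<map s xs>>%VS].
Proof.
pose P n := `[< exists xs : seq L, size xs = n /\ free (map s xs) >].
have exP : exists n, P n by exists 0%N; apply/asboolP; exists [::]; rewrite nil_free.
have leP n : P n -> (n <= \dim (@fullv _ V))%N.
  move=> /asboolP[xs [<-]]; rewrite /free size_map => /eqP <-.
  exact/dimvS/subvf.
have [n /asboolP[xs [<- fxs]] maxn] := ex_maxnP exP leP.
have inxs x : s x \in <<map s xs>>%VS.
  apply: contraT => xnot; have /maxn : P (size (x :: xs)).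
    by apply/asboolP; exists (x :: xs); rewrite /= free_cons xnot.
  by rewrite ltnn.
exists xs; split=> //; apply/seteqP; split=> v /=.
  move=> [l [lL]]; apply/subvP; elim: l lL => [|y l IHl] lL.
    by rewrite big_nil sub0v.
  rewrite big_cons subv_add IHl ?andbT => [|z zl]; last by apply: lL; rewrite inE zl orbT.
  have yL : y \in L by apply/mem_set/lL; rewrite mem_head.
  by rewrite (lift_line s (exist _ y yL)) -memvE inxs.
move: v; apply: span_ind => [|a u v /mapP[x _ ->]].
  exact: span_lines0.
exact/span_lines_comb/lift_mem.
Qed.

Lemma span_lines_ind L (s : lift_of L) (P : V -> Prop) :
  P 0 -> (forall a x v, P v -> P (a *: s x + v)) -> forall v, span_lines L v -> P v.
Proof.
move=> P0 PD v; have [xs [_ ->]] := span_lines_basis s.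
by apply: span_ind => // a _ w /mapP[x _ ->]; exact: PD.
Qed.

Lemma gram_val L (s : lift_of L) (e : edge (lines_graph b L)) x y :
  val e = [set x; y] -> val (gram s e) = - b (s x) (s y).
Proof.
apply: (ends_sym (F := fun x y : vertex (lines_graph b L) => - b (s x) (s y))) => u v.
by rewrite form_sym.
Qed.

Lemma ortho_lines_sym (x y : proj V) : ortho_lines b x y = ortho_lines b y x.
Proof. by apply/orthovP/orthovP => o u v uU vV; rewrite form_sym o. Qed.

Lemma lines_edgeE L (x y : L) :
  lines_edge b [set x; y] <-> ~~ ortho_lines b (val x) (val y).
Proof.
split=> [[x' [y' [E +]]]|nxy]; last by exists x, y.
by case: (set2_inj E) => -[-> ->] //; rewrite ortho_lines_sym.
Qed.

Lemma ortho_O_act (g : O_group b) (x y : proj V) :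
  ortho_lines b (O_act g x) (O_act g y) = ortho_lines b x y.
Proof.
have /andP[_ /asboolP giso] := valP g.
apply/orthovP/orthovP => o u v uU vV.
  by rewrite -giso o ?memv_img.
case/memv_imgP: uU vV => u' u'U -> /memv_imgP[v' v'V ->].
by rewrite giso o.
Qed.

Lemma O_act_inj (g : O_group b) : injective (O_act g).
Proof.
move=> x y /(congr1 val) /= gxy; apply: val_inj => /=.
have /andP[/lker0P ginj _] := valP g.
apply/vspaceP => v; apply/idP/idP => vx.
  by have := memv_img (val g) vx; rewrite gxy => /memv_imgP[w wy /ginj ->].
by have := memv_img (val g) vx; rewrite -gxy => /memv_imgP[w wy /ginj ->].
Qed.

Lemma lift_span_lines L (s : lift_of L) x : span_lines L (s x).
Proof.
rewrite -[s x]addr0 -[s x]scale1r.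
exact: span_lines_comb (lift_mem s _) (span_lines0 L).
Qed.

(** * From isometric lifts to an orthogonal map *)

Lemma isometric_lifts_extension L1 L2 (iota : L1 -> L2)
    (s1 : lift_of L1) (s2 : lift_of L2) :
  (forall y, exists x, iota x = y) -> nondeg_on b (span_lines L2) ->
  (forall x y, b (s2 (iota x)) (s2 (iota y)) = b (s1 x) (s1 y)) ->
  exists h : 'End(V), (forall x, h (s1 x) = s2 (iota x)) /\
    forall u v, span_lines L1 u -> span_lines L1 v -> b (h u) (h v) = b u v.
Proof.
move=> surj nd2 s12; have [xs [fxs W1E]] := span_lines_basis s1.
have [h0 h0E] := linear_of_free (map s1 xs) (map (s2 \o iota) xs).
have h0xs x : x \in xs -> h0 (s1 x) = s2 (iota x).
  have := h0E fxs; rewrite !size_map -map_comp => /(_ erefl) /eq_in_map.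
  exact.
(* [h0] is prescribed on a basis only, yet its pairings with every [s2 (iota y)] are already
   determined. *)
have hW v : v \in <<map s1 xs>>%VS -> span_lines L2 (h0 v) /\
    forall y, b (h0 v) (s2 (iota y)) = b v (s1 y).
  move: v; apply: span_ind => [|a _ v /mapP[x xX ->] [vL2 vE]].
    by split=> [|y]; rewrite linear0; [exact: span_lines0|rewrite !linear0l].
  rewrite linearP h0xs //; split; first exact: span_lines_comb (lift_mem s2 _) vL2.
  by move=> y; rewrite !linearDl !linearZl_LR /= vE s12.
have h0s x : h0 (s1 x) = s2 (iota x).
  have /hW[hx hxE] : s1 x \in <<map s1 xs>>%VS.
    by have := lift_span_lines s1 x; rewrite W1E.
  (* The difference lies in the span of [L2] and, [iota] being onto, is orthogonal to all [s2 y];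
     non-degeneracy kills it. *)
  apply/eqP; rewrite -subr_eq0; apply/eqP/nd2.
    have [ys [_ W2E]] := span_lines_basis s2.
    move: hx (lift_span_lines s2 (iota x)); rewrite W2E /=.
    exact: rpredB.
  apply: (span_lines_ind (s := s2)) => [|a y v IH]; first by rewrite linear0r.
  have [x' <-] := surj y.
  by rewrite linearDr linearZr /= IH linearBl /= hxE s12 subrr mulr0 addr0.
exists (linfun h0); split=> [x|u v uL vL]; rewrite !lfunE //=.
(* Induction on [v] alone suffices, as [hW] handles an arbitrary [u] paired with a lift. *)
move: v vL; apply: (span_lines_ind (s := s1)) => [|a x v IH].
  by rewrite linear0 !linear0r.
have /hW[_ uE] : u \in <<map s1 xs>>%VS by move: uL; rewrite W1E.
by rewrite linearP !linearDr !linearZr /= IH h0s uE.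
Qed.

Lemma isometric_lifts_O_act L1 L2 (iota : L1 -> L2)
    (s1 : lift_of L1) (s2 : lift_of L2) :
  (2 : F) != 0 -> nondegenerate b ->
  nondeg_on b (span_lines L1) -> nondeg_on b (span_lines L2) ->
  (forall y, exists x, iota x = y) ->
  (forall x y, b (s2 (iota x)) (s2 (iota y)) = b (s1 x) (s1 y)) ->
  exists g : O_group b, forall x : L1, O_act g (val x) = val (iota x).
Proof.
move=> two0 bnd nd1 nd2 surj s12.
have [h [hs hiso]] := isometric_lifts_extension surj nd2 s12.
have [xs [_ W1E]] := span_lines_basis s1; rewrite W1E in nd1 hiso.
have [|g giso gh] := @witt_extension _ _ b two0 _ h nd1.
  by move=> u v uW vW; apply: hiso.
have gO : orthogonal_map b g.
  by apply/andP; split; [exact: isometry_lker0 giso|exact/asboolP].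
exists (exist _ g gO) => x; apply: val_inj => /=.
rewrite (lift_line s1) (lift_line s2) limg_line gh ?hs //.
by have := lift_span_lines s1 x; rewrite W1E.
Qed.

(** * Orthogonal maps preserve the graph and the class *)

Definition transport_lift L1 L2 (psi : L2 -> L1) (g : O_group b)
  (gpsi : forall y, O_act g (val (psi y)) = val y) (s : lift_of L1) : lift_of L2.
Proof.
exists (fun y => val g (s (psi y))) => y.
  by rewrite -gpsi /= memv_img ?lift_mem.
have /andP[/lker0P ginj _] := valP g.
by apply: contra_neq (lift_neq0 s (psi y)) => gs0; apply: ginj; rewrite gs0 linear0.
Defined.

Lemma O_act_graph_iso L1 L2 (iota : L1 -> L2) (g : O_group b) :
  (forall x, O_act g (val x) = val (iota x)) ->
  (forall y, exists x, iota x = y) ->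
  exists phi : graph_mor (lines_graph b L1) (lines_graph b L2),
    [/\ mor_fun phi = iota, graph_iso phi &
         lines_class b L1 = H1_pull phi (lines_class b L2)].
Proof.
move=> giota surj; have [psi iotaK'] := choice surj.
have iota_inj : injective iota.
  by move=> x y xy; apply/val_inj/(@O_act_inj g); rewrite !giota xy.
have iotaK : cancel iota psi by move=> x; apply: iota_inj.
have oiota x y : ortho_lines b (val (iota x)) (val (iota y)) = ortho_lines b (val x) (val y).
  by rewrite -!giota ortho_O_act.
have mor1 e : edge (lines_graph b L1) e -> edge (lines_graph b L2) (iota @` e).
  move=> [x [y [-> nxy]]]; exists (iota x), (iota y); split; last by rewrite oiota.
  by rewrite image_setU !image_set1.
have mor2 e : edge (lines_graph b L2) e -> edge (lines_graph b L1) (psi @` e).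
  move=> [x [y [-> nxy]]]; exists (psi x), (psi y); split.
    by rewrite image_setU !image_set1.
  by rewrite -oiota !iotaK'.
pose phi : graph_mor (lines_graph b L1) (lines_graph b L2) := GraphMor mor1.
exists phi; split=> //; first by exists (GraphMor mor2).
have gpsi y : O_act g (val (psi y)) = val y by rewrite giota iotaK'.
(* The class of [L2] may be computed with the lift transported from [s] by [g]; its Gram cocycle
   then pulls back to that of [s] exactly, with no coboundary left. *)
set s := vpick_lift L1.
rewrite /lines_class (gram_class_lift b (vpick_lift L2) (transport_lift gpsi s)).
rewrite H1_pullE; congr cclass; apply/funext => e; apply: val_inj.
rewrite /C1_pull (@gram_val _ _ _ (phi (ends e).1) (phi (ends e).2)) /=; last first.
  by rewrite -[LHS]/(iota @` val e) (endsE e) image_setU !image_set1.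
have /andP[_ /asboolP giso] := valP g.
by rewrite giso !iotaK.
Qed.

(** * From equal classes to isometric lifts *)

Lemma class_isometric_lifts L1 L2 (phi : graph_mor (lines_graph b L1) (lines_graph b L2)) :
  graph_iso phi -> lines_class b L1 = H1_pull phi (lines_class b L2) ->
  exists (s1 : lift_of L1) (s2 : lift_of L2),
    forall x y, b (s2 (phi x)) (s2 (phi y)) = b (s1 x) (s1 y).
Proof.
move=> [psi [phiK _]]; set s1 := vpick_lift L1; set s2 := vpick_lift L2.
rewrite H1_pullE => /cclassP[f fE].
(* In multiplicative terms [gram s1] is the pullback of [gram s2] times [diff f], and [- f x] is the
   inverse of [f x]: dividing [s1] by [f] absorbs the coboundary. *)
exists (scale_lift (fun x => - f x) s1), s2 => x y /=.
rewrite linearZl_LR linearZr /=.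
(* The cocycles say nothing about orthogonal pairs. There both sides vanish, because [psi] would
   bring an edge between the images back to one between [x] and [y]. *)
have [oxy|nxy] := boolP (ortho_lines b (val x) (val y)).
  have := oxy; rewrite (ortho_lines_lift b s1) => /eqP ->; rewrite !mulr0.
  apply/eqP; rewrite -(ortho_lines_lift b s2); apply: contraLR oxy => nphi.
  have /(mor_edge psi) : edge (lines_graph b L2) [set phi x; phi y] by exact/lines_edgeE.
  by rewrite image_setU !image_set1 !phiK => /lines_edgeE.
have exy : lines_edge b [set x; y] by exact/lines_edgeE.
pose e : edge (lines_graph b L1) := exist _ [set x; y] (mem_set exy).
have g1 := @gram_val _ s1 e x y erefl.
have g2 : val (gram s2 (edge_map phi e)) = - b (s2 (phi x)) (s2 (phi y)).
  by apply: gram_val; rewrite /= image_setU !image_set1.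
have c0 := valP (gram s2 (edge_map phi e)); rewrite g2 oppr_eq0 in c0.
have fxy : val (gram s1 e) / val (gram s2 (edge_map phi e)) = val (f x) * val (f y).
  by rewrite -[RHS]/(val (f x + f y)) -(@diffE _ _ f e x y) // -fE.
have -> : b (s1 x) (s1 y) = val (f x) * val (f y) * b (s2 (phi x)) (s2 (phi y)).
  by rewrite -fxy g1 g2 invrN mulrNN mulfVK.
by rewrite mulrA -invfM mulKf // mulf_neq0 ?(valP (f x)) ?(valP (f y)).
Qed.

End Lines.

(** Surjectivity is part of the first condition: the inclusion of a proper subset extends by the
    identity but is no isomorphism of graphs. *)
Theorem mainTheorem3 (R : realType) (p q : nat) (p_gt0 : (0 < p)%N)
    (b : {symmetric 'rV[R]_(p + q)})
    (b_nondeg : nondegenerate b) (b_sig : has_signature b p q)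
    (L1 L2 : set (proj 'rV[R]_(p + q)))
    (L1_nondeg : nondeg_on b (span_lines L1))
    (L2_nondeg : nondeg_on b (span_lines L2))
    (iota : L1 -> L2) :
  (extends_to_PO b iota /\ (forall y : L2, exists x : L1, iota x = y))
  <->
  (exists phi : graph_mor (lines_graph b L1) (lines_graph b L2),
     [/\ mor_fun phi = iota, graph_iso phi &
         lines_class b L1 = H1_pull phi (lines_class b L2)]).
Proof.
split=> [[[g giota] surj]|[phi [phiE phi_iso phi_class]]].
  exact: O_act_graph_iso giota surj.
have surj (y : L2) : exists x : L1, iota x = y.
  by have [psi [_ psiK]] := phi_iso; exists (psi y); rewrite -phiE psiK.
split=> //; have [s1 [s2 s12]] := class_isometric_lifts phi_iso phi_class.
rewrite phiE in s12.
have [|g gE] := isometric_lifts_O_act _ b_nondeg L1_nondeg L2_nondeg surj s12.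
  by rewrite pnatr_eq0.
by exists (\pi_({eq_quot (@eq_sign _ _ b)})%qT g) => x; rewrite PO_actE.
Qed.
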